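(* For every integer $k \ge 0$, the $2^{k+1}\times 2^{k+1}$ diagonal matrix $\mathbf{I}_k \oplus \mathbf{\Omega}_k$ admits the decomposition $$\mathbf{I}_k \oplus \mathbf{\Omega}_k = \prod_{i=1}^{k} \Big[ E_1 \otimes \mathbf{I}_{i-1} \otimes I_2 \otimes \mathbf{I}_{k-i} \;+\; E_2 \otimes \mathbf{I}_{i-1} \otimes R_{i+1} \otimes \mathbf{I}_{k-i}\Big].$$
   Context: $\otimes$ denotes the Kronecker product of matrices, and $A \oplus B = \begin{bmatrix} A & 0\\ 0 & B\end{bmatrix}$ is the block-diagonal direct sum. $\mathbf{I}_m$ denotes the $2^m \times 2^m$ identity matrix (so $\mathbf{I}_0 = [1]$), and $I_2$ is the $2\times 2$ identity. For an integer $m\ge 0$, $\omega_{2^m} := \exp\left(\frac{-2\pi \mathrm{i}}{2^m}\right)$. For $k\ge 0$, $\mathbf{\Omega}_k$ is the $2^k\times 2^k$ diagonal matrix $\mathbf{\Omega}_k := \mathrm{diag}\left(\omega_{2^{k+1}}^{0}, \omega_{2^{k+1}}^{1}, \ldots, \omega_{2^{k+1}}^{2^k-1}\right)$. For $m \ge 1$, $R_m := \begin{bmatrix} 1 & 0 \\ 0 & \omega_{2^m}\end{bmatrix}$. $E_1 := \begin{bmatrix} 1 & 0\\ 0 & 0\end{bmatrix}$ and $E_2 := \begin{bmatrix} 0 & 0\\ 0 & 1\end{bmatrix}$. The empty product ($k=0$) is the identity matrix. *)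

(* Defs.v *)
From mathcomp Require Import all_boot all_order all_algebra.
From mathcomp Require Import reals trigo sequences exp.
From mathcomp Require Import complex mxtens.

Set Implicit Arguments.
Unset Strict Implicit.
Unset Printing Implicit Defensive.

Import Order.TTheory GRing.Theory Num.Theory.

Local Open Scope ring_scope.
Local Open Scope complex_scope.

(* Complex exponential: e^(x + i y) = e^x (cos y + i sin y). *)
Definition cexp (R : realType) (z : R[i]) : R[i] :=
  (expR (complex.Re z))%:C * (cos (complex.Im z) +i* sin (complex.Im z)).

(* The negative sign is the DFT convention: omega N = e^(-2 pi i / N). *)
Definition omega (R : realType) (N : nat) : R[i] :=
  cexp ((- 2 * (pi : R)%:C * 'i) / N%:R).

Definition idpow2 (R : realType) (m : nat) : 'M[R[i]]_(2 ^ m) := 1%:M.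

Definition Omegamx (R : realType) (k : nat) : 'M[R[i]]_(2 ^ k) :=
  diag_mx (\row_(j < 2 ^ k) omega R (2 ^ k.+1) ^+ j).

Definition Rmx (R : realType) (m : nat) : 'M[R[i]]_2 :=
  diag_mx (\row_(j < 2) if j == 0 then 1 else omega R (2 ^ m)).

Definition E1 (R : realType) : 'M[R[i]]_2 := delta_mx 0 0.
Definition E2 (R : realType) : 'M[R[i]]_2 := delta_mx 1 1.

Definition dsummx (F : pzRingType) (m n : nat) (A : 'M[F]_m) (B : 'M[F]_n) :
  'M[F]_(m + n) := block_mx A 0 0 B.

Notation "A \oplus B" := (dsummx A B)
  (at level 50, left associativity) : ring_scope.
Notation "A \otimes B" := (tensmx A B)
  (at level 40, left associativity) : ring_scope.

Lemma dsum_dim (k : nat) : (2 ^ k + 2 ^ k = 2 ^ k.+1)%N.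
Proof. by rewrite expnS mul2n addnn. Qed.

(* i : 'I_k is 0-based, so the i-th factor carries identities of sizes 2 ^ i
   and 2 ^ (k - i.+1). *)
Lemma factor_dim (k : nat) (i : 'I_k) :
  (2 * 2 ^ i * 2 * 2 ^ (k - i.+1) = 2 ^ k.+1)%N.
Proof. by rewrite -expnS -expnSr -expnD addSn subnKC. Qed.

Definition sqcast (F : Type) (m n : nat) (e : m = n) (A : 'M[F]_m) :
  'M[F]_n := castmx (e, e) A.

(* Main.v *)
(* All the matrices are diagonal. Writing 2 ^ k + j for an index in the lower
   half, the i-th factor contributes omega (2 ^ (i + 2)) raised to the binary
   digit of j of weight 2 ^ (k - 1 - i), and omega (2 ^ (i + 2)) is the
   2 ^ (k - 1 - i)-th power of omega (2 ^ (k + 1)); hence the factors multiply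
   to omega (2 ^ (k + 1)) ^ j. *)
Require Import Defs.
From mathcomp Require Import all_boot all_order all_algebra.
From mathcomp Require Import reals trigo sequences exp.
From mathcomp Require Import complex mxtens.
From mathcomp Require Import ring.

Import Order.TTheory GRing.Theory Num.Theory.

Local Open Scope ring_scope.

Lemma cexpD (R : realType) (x y : R[i]) : cexp (x + y) = cexp x * cexp y.
Proof.
case: x y => [a b] [c d]; rewrite /cexp /= expRD cosD sinD rmorphM /= mulrACA.
by congr (_ * _); apply/eqP; rewrite eq_complex /= [sin b * _ + _]addrC !eqxx.
Qed.

Lemma omega_sqr (R : realType) (m : nat) :
  omega R (2 ^ m.+1) ^+ 2 = omega R (2 ^ m).
Proof.
rewrite expr2 /omega -cexpD; congr cexp.
rewrite expnS natrM; field.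
by rewrite natrX expf_neq0 // pnatr_eq0.
Qed.

(** Induction on [k], splitting off the lowest binary digit of [j]. Leaving [j] unbounded, with a
    residue on the right, allows use at a matrix index that still has its leading bit. *)
Lemma prod_omega_digits (R : realType) (k j : nat) :
  \prod_(i < k) omega R (2 ^ i.+2) ^+ ((j %/ 2 ^ (k - i.+1)) %% 2) =
  omega R (2 ^ k.+1) ^+ (j %% 2 ^ k).
Proof.
elim: k j => [|k IHk] j; first by rewrite big_ord0 modn1.
rewrite big_ord_recr /= subnn divn1.
(* All factors but the last read the digits of [j %/ 2]. *)
under eq_bigr => i _ do rewrite subSn // [(2 ^ (_ - _).+1)%N]expnS divnMA.
rewrite IHk -[omega R (2 ^ k.+1)]omega_sqr -exprM -exprD; congr (_ ^+ _).
(* Dividing [j %% 2 ^ k.+1] by 2 leaves quotient [(j %/ 2) %% 2 ^ k] and remainder [j %% 2]. *)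
rewrite mulnC modn_divl -expnSr [in RHS](divn_eq (j %% 2 ^ k.+1) 2).
by rewrite modn_dvdm // expnS dvdn_mulr.
Qed.

(** Entries are indexed by [nat] rather than by ordinals, so that dimension casts leave [f]
    unchanged. *)
Definition diagf {K : pzRingType} (n : nat) (f : nat -> K) : 'M[K]_n :=
  diag_mx (\row_(i < n) f i).

Lemma eq_diagf (K : pzRingType) (n : nat) (f g : nat -> K) :
  (forall i, (i < n)%N -> f i = g i) -> diagf n f = diagf n g.
Proof.
by move=> fg; congr diag_mx; apply/rowP => i; rewrite !mxE fg.
Qed.

Lemma diagfD (K : pzRingType) (n : nat) (f g : nat -> K) :
  diagf n f + diagf n g = diagf n (fun a => f a + g a).
Proof. by rewrite -raddfD; congr diag_mx; apply/rowP => i; rewrite !mxE. Qed.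

Lemma diagf_prod (K : pzRingType) (n k : nat) (f : 'I_k -> nat -> K) :
  \prod_i diagf n (f i) = diagf n (fun a => \prod_i f i a).
Proof.
elim: k f => [|k IHk] f.
  rewrite big_ord0; apply/matrixP => a b; rewrite !mxE big_ord0.
  by case: eqP.
rewrite big_ord_recl IHk; apply: etrans (mulmx_diag _ _) _.
by congr diag_mx; apply/rowP => a; rewrite !mxE big_ord_recl.
Qed.

Lemma sqcast_diagf (K : pzRingType) (m n : nat) (e : m = n) (f : nat -> K) :
  sqcast e (diagf m f) = diagf n f.
Proof. by case: n / e; rewrite /sqcast castmx_id. Qed.

Lemma tensmx_diagf (K : pzRingType) (m n : nat) (f g : nat -> K) :
  diagf m f \otimes diagf n g =
  diagf (m * n) (fun a => f (a %/ n)%N * g (a %% n)%N).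
Proof.
apply/matrixP => a b; rewrite !mxE.
(* Two indices agree iff their quotients and remainders by [n] both agree. *)
by rewrite -[a == b](can_eq (@mxtens_unindexK m n)) xpair_eqE mulrnAr mulrnAl
  -mulrnA mulnb andbC.
Qed.

Lemma dsummx_diagf (K : pzRingType) (m n : nat) (f g : nat -> K) :
  diagf m f \oplus diagf n g =
  diagf (m + n) (fun a => if (a < m)%N then f a else g (a - m)%N).
Proof.
rewrite /dsummx -diag_mx_row; congr diag_mx; apply/rowP => a.
by rewrite !mxE; case: split_ordP => j ->; rewrite mxE ?addKn.
Qed.

Lemma scalar_diagf (K : pzRingType) (n : nat) : 1%:M = diagf n (fun=> 1 : K).
Proof. by apply/matrixP => a b; rewrite !mxE. Qed.

Lemma E1_diagf (R : realType) : E1 R = diagf 2 (fun a => (a == 0%N)%:R).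
Proof. by apply/matrixP => -[[|[|//]] ?] [[|[|//]] ?]; rewrite !mxE. Qed.

Lemma E2_diagf (R : realType) : E2 R = diagf 2 (fun a => (a == 1%N)%:R).
Proof. by apply/matrixP => -[[|[|//]] ?] [[|[|//]] ?]; rewrite !mxE. Qed.

(** A power replaces the case split, so that a binary digit becomes an exponent. *)
Lemma Rmx_diagf (R : realType) (m : nat) :
  Rmx R m = diagf 2 (fun a => omega R (2 ^ m) ^+ a).
Proof. by congr diag_mx; apply/rowP => -[[|[|//]] ?]; rewrite !mxE. Qed.

(* The index i : 'I_k runs over 0, ..., k - 1; the usual 1-based index of the
   factor is i.+1. *)
Theorem theorem3 (R : realType) (k : nat) :
  sqcast (dsum_dim k) (idpow2 R k \oplus Omegamx R k) =
  \prod_(i < k)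
    sqcast (factor_dim i)
      (E1 R \otimes idpow2 R i \otimes 1%:M \otimes idpow2 R (k - i.+1)
       + E2 R \otimes idpow2 R i \otimes Rmx R i.+2 \otimes
           idpow2 R (k - i.+1)).
Proof.
rewrite /idpow2 !scalar_diagf dsummx_diagf sqcast_diagf.
under eq_bigr => i _ do rewrite !scalar_diagf E1_diagf E2_diagf Rmx_diagf
  !tensmx_diagf diagfD sqcast_diagf.
rewrite diagf_prod; apply: eq_diagf => a lt_a /=.
(* In every factor, [E1] and [E2] see the same leading bit of [a]. *)
have top (i : 'I_k) : (a %/ 2 ^ (k - i.+1) %/ 2 %/ 2 ^ i = a %/ 2 ^ k)%N.
  by rewrite -!divnMA -expnS -expnD subnK.
under eq_bigr => i _ do rewrite top !mulr1.
case: ltnP => [lt_ak | le_ka].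
  by rewrite divn_small // big1 // => i _; rewrite mul0r addr0.
have lt_j : (a - 2 ^ k < 2 ^ k)%N by rewrite ltn_subLR // addnn -mul2n -expnS.
have a_div : (a %/ 2 ^ k = 1)%N.
  by rewrite -(subnK le_ka) divnDr // divnn expn_gt0 divn_small.
have a_mod : (a %% 2 ^ k = a - 2 ^ k)%N.
  by rewrite -[in LHS](subnK le_ka) modnDr modn_small.
(* With leading bit 1 only the [E2] terms survive, and they read the digits of [a] itself. *)
rewrite a_div -a_mod -prod_omega_digits.
by apply: eq_bigr => i _; rewrite add0r mul1r.
Qed.
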